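(* The homogeneous spaces $FL_j$ $(j=1,2,3)$ defined in the context, represented as $\mathrm{SU}_3/\mathrm U_1$ with $\mathrm U_1=\{\operatorname{diag}(a,a^{-1},1)\mid a\in S^1\}$ the stabilizer of a suitable point, are $6$-symmetric spaces (with respect to the order $6$ automorphism $\sigma(g)=P(g^T)^{-1}P$ of $\mathrm{SL}_3\mathbb C$). Furthermore, they are naturally equivariantly diffeomorphic: for all $j,m\in\{1,2,3\}$ there is a diffeomorphism $\phi_{jm}:FL_m\to FL_j$ with $\phi_{jm}(g.p)=g.\phi_{jm}(p)$ for all $g\in\mathrm{SU}_3$ and $p\in FL_m$.
   Context: $k$-symmetric space: let $G$ be a complex Lie group, $\tau$ an anti-holomorphic involution of $G$ with fixed point group $G^{\mathbb R}=\mathrm{Fix}(G,\tau)$, and $\sigma$ an automorphism of $G$ of order $k\ge2$ commuting with $\tau$ (hence leaving $G^{\mathbb R}$ invariant). A homogeneous space $G^{\mathbb R}/G^{\mathbb R}_0$ is a $k$-symmetric space if $\mathrm{Fix}(G^{\mathbb R},\sigma)^\circ\subset G^{\mathbb R}_0\subset\mathrm{Fix}(G^{\mathbb R},\sigma)$, where $^\circ$ denotes the identity component. Here $G=\mathrm{SL}_3\mathbb C$, $\tau(g)=(\bar g^T)^{-1}$, $G^{\mathbb R}=\mathrm{SU}_3$, and $P=\begin{pmatrix}0&\epsilon^2&0\\ \epsilon^4&0&0\\0&0&1\end{pmatrix}$, $\epsilon=e^{\pi i/3}$. Let $e_1,e_2,e_3$ be the standard basis of $\mathbb C^3$, $\tilde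 e_1=(\frac{1+i}2,\frac{1-i}2,0)^T$, $\tilde e_2=(\frac{1-i}2,\frac{1+i}2,0)^T$, and $V_0=\operatorname{span}_{\mathbb R}\{\tilde e_1,\tilde e_2,e_3\}$, an oriented real Lagrangian subspace of $\mathbb C^3$ for the symplectic form $\operatorname{Im}\langle\cdot,\cdot\rangle$. $\mathrm{SL_{Gr}}(3,\mathbb C^3)$ is the $\mathrm{SU}_3$-orbit of $V_0$ in the set of oriented Lagrangian subspaces. $FL_1=\{(v,V)\mid v\in S^5,\ v\in V,\ V\in \mathrm{SL_{Gr}}(3,\mathbb C^3)\}$, with action $g.(v,V)=(gv,gV)$. $FL_2$ is the set of pairs $(w,\mathcal W)$ where $w\in S^5$ and $\mathcal W=(0\subset W_1\subset W_2\subset W_3=\mathbb C^3)$ is a full flag of complex subspaces, $\dim_{\mathbb C}W_j=j$, with $W_1=\mathbb Cw$; action $g.(w,\mathcal W)=(gw,g\mathcal W)$. $FL_3=\{UPU^T\mid U\in\mathrm{SU}_3\}$, with action $g.Q=gQg^T$. *)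

(* Defs.v *)
From HB Require Import structures.
From mathcomp Require Import all_boot all_order all_algebra.
From mathcomp Require Import complex.
From mathcomp Require Import all_classical all_reals all_analysis.

Set Implicit Arguments.
Unset Strict Implicit.
Unset Printing Implicit Defensive.

Import Order.TTheory GRing.Theory Num.Theory numFieldNormedType.Exports.

Local Open Scope classical_set_scope.
Local Open Scope ring_scope.
Local Open Scope complex_scope.

(* These definitions are stated over an abstract numFieldType because R[i]
   gets its topology only through that structure.  They are used at
   K := R[i], where being differentiable at every point of an open set means
   being holomorphic there. *)
Definition holomorphic_on (K : numFieldType) (n : nat)
    (O : set 'M[K]_n) (f : 'M[K]_n -> K) : Prop :=
  forall x, O x -> differentiable f x.

(* A map on a subset S of M_n(K) is holomorphic when it extends locally to a
   holomorphic map between open subsets of M_n(K); on a closed complex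
   submanifold of an open subset this is the intrinsic notion. *)
Definition holomorphic_map (K : numFieldType) (n : nat)
    (S : set 'M[K]_n) (s : 'M[K]_n -> 'M[K]_n) : Prop :=
  forall g, S g -> exists O : set 'M[K]_n, exists F : 'M[K]_n -> 'M[K]_n,
    [/\ open O, O g,
        forall i j, holomorphic_on O (fun h => F h i j)
      & forall h, S h -> O h -> s h = F h].

Definition identity_component (K : numFieldType) (n : nat)
    (A : set 'M[K]_n) : set 'M[K]_n :=
  connected_component A 1%:M.

Definition conj_mx (R : realType) (m n : nat) (A : 'M[R[i]]_(m, n))
    : 'M[R[i]]_(m, n) :=
  map_mx (@conjc R) A.

Definition matrix_group (R : realType) (n : nat) (G : set 'M[R[i]]_n) : Prop :=
  [/\ G 1%:M,
      forall g h, G g -> G h -> G (g *m h)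
    & forall g, G g -> g \in unitmx /\ G (invmx g)].

(* A closed complex Lie subgroup of GL_n(C): a subgroup that is a closed
   analytic subset.  As GL_n(C) is a Stein manifold, such a subset is the
   common zero locus of holomorphic functions on GL_n(C). *)
Definition complex_lie_group (R : realType) (n : nat) (G : set 'M[R[i]]_n)
    : Prop :=
  matrix_group G /\
  exists (I : Type) (F : I -> 'M[R[i]]_n -> R[i]),
    (forall i, holomorphic_on [set g : 'M[R[i]]_n | g \in unitmx] (F i)) /\
    G = [set g | g \in unitmx /\ forall i, F i g = 0].

Definition group_endomorphism (R : realType) (n : nat)
    (G : set 'M[R[i]]_n) (s : 'M[R[i]]_n -> 'M[R[i]]_n) : Prop :=
  (forall g, G g -> G (s g)) /\
  (forall g h, G g -> G h -> s (g *m h) = s g *m s h).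

Definition antiholomorphic_involution (R : realType) (n : nat)
    (G : set 'M[R[i]]_n) (tau : 'M[R[i]]_n -> 'M[R[i]]_n) : Prop :=
  [/\ group_endomorphism G tau,
      forall g, G g -> tau (tau g) = g
    & holomorphic_map G (fun g => conj_mx (tau g))].

(* Bijectivity of s on G, and holomorphy of its inverse, follow from
   s^k = id on G. *)
Definition automorphism_of_order (R : realType) (n k : nat)
    (G : set 'M[R[i]]_n) (s : 'M[R[i]]_n -> 'M[R[i]]_n) : Prop :=
  [/\ group_endomorphism G s,
      holomorphic_map G s,
      (0 < k)%N,
      forall g, G g -> iter k s g = g
    & forall l : nat, (0 < l < k)%N -> exists2 g, G g & iter l s g <> g].

Definition Fix (R : realType) (n : nat)
    (G : set 'M[R[i]]_n) (s : 'M[R[i]]_n -> 'M[R[i]]_n) : set 'M[R[i]]_n :=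
  [set g | G g /\ s g = g].

Definition k_symmetric_space (R : realType) (n k : nat)
    (G : set 'M[R[i]]_n) (tau sigma : 'M[R[i]]_n -> 'M[R[i]]_n)
    (GR G0 : set 'M[R[i]]_n) : Prop :=
  [/\ complex_lie_group G,
      antiholomorphic_involution G tau,
      (2 <= k)%N /\ automorphism_of_order k G sigma
    & forall g, G g -> sigma (tau g) = tau (sigma g)] /\
  [/\ GR = Fix G tau,
      matrix_group G0,
      identity_component (Fix GR sigma) `<=` G0
    & G0 `<=` Fix GR sigma].

Definition mx3 (K : nmodType) (s : seq (seq K)) : 'M[K]_3 :=
  \matrix_(i, j) nth 0 (nth [::] s i) j.

Definition SL3 (R : realType) : set 'M[R[i]]_3 := [set g | \det g = 1].

Definition SU3 (R : realType) : set 'M[R[i]]_3 :=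
  [set g | (conj_mx g)^T *m g = 1%:M /\ \det g = 1].

Definition U1 (R : realType) : set 'M[R[i]]_3 :=
  [set mx3 [:: [:: a; 0; 0]; [:: 0; a^-1; 0]; [:: 0; 0; 1]]
     | a in [set a : R[i] | `|a| = 1]].

Definition epsilon (R : realType) : R[i] :=
  cos (pi / 3%:R) +i* sin (pi / 3%:R).

Definition Pmx (R : realType) : 'M[R[i]]_3 :=
  mx3 [:: [:: 0; epsilon R ^+ 2; 0]; [:: epsilon R ^+ 4; 0; 0]; [:: 0; 0; 1]].

Definition tau3 (R : realType) (g : 'M[R[i]]_3) : 'M[R[i]]_3 :=
  invmx (conj_mx g)^T.

Definition sigma6 (R : realType) (g : 'M[R[i]]_3) : 'M[R[i]]_3 :=
  Pmx R *m invmx g^T *m Pmx R.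

(* A set on which a group of 3x3 complex matrices acts: [gact] is total, only
   its restriction to the group and to [gset] matters. *)
Record gspace (R : realType) := GSpace {
  gpoint : Type;
  gact : 'M[R[i]]_3 -> gpoint -> gpoint;
  gset : set gpoint
}.
Arguments gset {R} g.

(* [X] is a homogeneous [G]-space and [H] is the stabilizer of one of its
   points, so that X = G/H. *)
Definition represented_as (R : realType) (X : gspace R) (G H : set 'M[R[i]]_3)
    : Prop :=
  [/\ forall q, gset X q -> gact 1%:M q = q,
      forall g h q, G g -> G h -> gset X q ->
        gact (g *m h) q = gact g (gact h q)
    & exists p : gpoint X,
      [/\ gset X p,
          [set gact g p | g in G] = gset X
        & [set g | G g /\ gact g p = p] = H]].

Fixpoint Ck_on (R : realType) (V : normedModType R) (k : nat)
    (O : set V) (f : V -> R) : Prop :=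
  match k with
  | 0%N => forall x, O x -> {for x, continuous f}
  | l.+1 => (forall x, O x -> differentiable f x) /\
            forall v : V, Ck_on l O (fun x => 'd f x v)
  end.

Definition smooth_on (R : realType) (V : normedModType R)
    (O : set V) (f : V -> R) : Prop :=
  forall k, Ck_on k O f.

(* M_3(C) as a real normed space. *)
Definition realify (R : realType) (g : 'M[R[i]]_3) : 'M[R]_3 * 'M[R]_3 :=
  (map_mx (@complex.Re R) g, map_mx (@complex.Im R) g).

Definition SU3_open (R : realType) (A : set 'M[R[i]]_3) : Prop :=
  exists2 O : set ('M[R]_3 * 'M[R]_3), open O &
    A = [set g | SU3 g /\ O (realify g)].

(* Smoothness for the structure of SU_3 as a submanifold of M_3(C): local
   extension to a smooth function on an open subset of M_3(C). *)
Definition SU3_smooth (R : realType) (A : set 'M[R[i]]_3)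
    (f : 'M[R[i]]_3 -> R) : Prop :=
  forall g, A g ->
    exists O : set ('M[R]_3 * 'M[R]_3), exists F : 'M[R]_3 * 'M[R]_3 -> R,
      [/\ open O, O (realify g), smooth_on O F
        & forall h, A h -> O (realify h) -> f h = F (realify h)].

(* The manifold structure of a homogeneous space SU_3/H, given by its sheaf of
   smooth functions: a subset is open, resp. a function on an open subset is
   smooth, iff its pull-back along the projection SU_3 -> SU_3/H is.  The
   projections are the orbit maps g |-> g.p; on a homogeneous space every base
   point p gives the same structure. *)
Definition orbit_preimage (R : realType) (X : gspace R) (p : gpoint X)
    (W : set (gpoint X)) : set 'M[R[i]]_3 :=
  [set g | SU3 g /\ W (gact g p)].

Definition homog_open (R : realType) (X : gspace R) (W : set (gpoint X)) : Prop :=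
  W `<=` gset X /\
  forall p, gset X p -> SU3_open (orbit_preimage p W).

Definition homog_smooth (R : realType) (X : gspace R) (W : set (gpoint X))
    (f : gpoint X -> R) : Prop :=
  forall p, gset X p ->
    SU3_smooth (orbit_preimage p W) (fun g => f (gact g p)).

Definition smooth_map (R : realType) (X Y : gspace R)
    (phi : gpoint X -> gpoint Y) : Prop :=
  [/\ forall p, gset X p -> gset Y (phi p),
      forall W, homog_open W -> homog_open (gset X `&` phi @^-1` W)
    & forall W f, homog_open W -> homog_smooth W f ->
        homog_smooth (gset X `&` phi @^-1` W) (f \o phi)].

Definition diffeomorphism (R : realType) (X Y : gspace R)
    (phi : gpoint X -> gpoint Y) : Prop :=
  smooth_map phi /\
  exists psi : gpoint Y -> gpoint X,
    [/\ smooth_map psi,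
        forall p, gset X p -> psi (phi p) = p
      & forall q, gset Y q -> phi (psi q) = q].
Arguments diffeomorphism {R} X Y phi.

Definition equivariant (R : realType) (X Y : gspace R)
    (phi : gpoint X -> gpoint Y) : Prop :=
  forall g p, SU3 g -> gset X p -> phi (gact g p) = gact g (phi p).
Arguments equivariant {R} X Y phi.

Definition sphere5 (R : realType) : set 'cV[R[i]]_3 :=
  [set v | \sum_i `|v i 0| ^+ 2 = 1].

Definition symplectic_form (R : realType) (u v : 'cV[R[i]]_3) : R :=
  complex.Im (\sum_i u i 0 * conjc (v i 0)).

Definition complexify (R : realType) (m n : nat) (A : 'M[R]_(m, n))
    : 'M[R[i]]_(m, n) :=
  map_mx (real_complex R) A.

(* Frames are given by the columns of a matrix. *)
Definition real_span (R : realType) (F : 'M[R[i]]_3) : set 'cV[R[i]]_3 :=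
  [set F *m complexify x | x in [set: 'cV[R]_3]].

Definition real_free (R : realType) (F : 'M[R[i]]_3) : Prop :=
  forall x : 'cV[R]_3, F *m complexify x = 0 -> x = 0.

(* An oriented real subspace of real dimension 3 is encoded by its underlying
   set together with the set of its positively oriented bases. *)
Definition oriented_subspace (R : realType) : Type :=
  (set 'cV[R[i]]_3 * set 'M[R[i]]_3)%type.

Definition oriented_span (R : realType) (F : 'M[R[i]]_3)
    : oriented_subspace R :=
  (real_span F,
   [set F *m complexify A | A in [set A : 'M[R]_3 | 0 < \det A]]).

Definition oriented_lagrangian (R : realType) : set (oriented_subspace R) :=
  [set V | exists F : 'M[R[i]]_3,
     [/\ real_free F,
         forall u v, real_span F u -> real_span F v -> symplectic_form u v = 0
       & V = oriented_span F]].

Definition act_oriented (R : realType) (g : 'M[R[i]]_3)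
    (V : oriented_subspace R) : oriented_subspace R :=
  ([set g *m v | v in V.1], [set g *m F | F in V.2]).

(* V_0 with the orientation of the basis given by the columns, which are
   e~_1, e~_2, e_3. *)
Definition V0 (R : realType) : oriented_subspace R :=
  oriented_span
    (mx3 [:: [:: 2^-1 +i* 2^-1; 2^-1 -i* 2^-1; 0];
             [:: 2^-1 -i* 2^-1; 2^-1 +i* 2^-1; 0];
             [:: 0; 0; 1]]).

Definition SLGr (R : realType) : set (oriented_subspace R) :=
  [set V | oriented_lagrangian V /\
           exists2 g : 'M[R[i]]_3, SU3 g & V = act_oriented g (V0 R)].

Definition FL1 (R : realType) : gspace R :=
  @GSpace R ('cV[R[i]]_3 * oriented_subspace R)%type
    (fun g x => (g *m x.1, act_oriented g x.2))
    [set x | [/\ sphere5 x.1, x.2.1 x.1 & SLGr x.2]].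

(* A flag is the triple (W_1, W_2, W_3). *)
Definition flag3 (R : realType) : Type :=
  ({vspace 'cV[R[i]]_3} * {vspace 'cV[R[i]]_3} * {vspace 'cV[R[i]]_3})%type.

Definition full_flag (R : realType) (W : flag3 R) : Prop :=
  let: (W1, W2, W3) := W in
  [/\ [/\ (W1 <= W2)%VS, (W2 <= W3)%VS & W3 = fullv],
      \dim W1 = 1%N, \dim W2 = 2%N & \dim W3 = 3%N].

Definition act_flag (R : realType) (g : 'M[R[i]]_3) (W : flag3 R) : flag3 R :=
  let: (W1, W2, W3) := W in
  let f : 'End('cV[R[i]]_3) := linfun (mulmx g) in
  ((f @: W1)%VS, (f @: W2)%VS, (f @: W3)%VS).

Definition FL2 (R : realType) : gspace R :=
  @GSpace R ('cV[R[i]]_3 * flag3 R)%type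
    (fun g x => (g *m x.1, act_flag g x.2))
    [set x | [/\ sphere5 x.1, full_flag x.2 & x.2.1.1 = <[x.1]>%VS]].

Definition FL3 (R : realType) : gspace R :=
  @GSpace R 'M[R[i]]_3
    (fun g Q => g *m Q *m g^T)
    [set U *m Pmx R *m U^T | U in @SU3 R].

(* FL_1, FL_2, FL_3, indexed from 0. *)
Definition FL (R : realType) (j : 'I_3) : gspace R :=
  nth (FL1 R) [:: FL1 R; FL2 R; FL3 R] j.

(* Main.v *)
(* SU_3 acts transitively on each FL_j, and a suitable base point has stabilizer
   exactly U_1: (e_3, V_0) for FL_1, (e_3, Ce_3 < Ce_3 + Ce_1 < C^3) for FL_2
   and P for FL_3.  Two homogeneous spaces with a common stabilizer are
   identified by g.p |-> g.q, and both smooth structures are the quotient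
   structure of SU_3 / U_1.

   Since P^2 = 1, being fixed by sigma means g P g^T = P, that is, stabilizing
   the base point of FL_3; such a g commutes with the diagonal matrix P^T P,
   whose entries are the three cube roots of unity, so it lies in U_1.  Hence
   Fix(SU_3, sigma) = U_1.  The square of sigma multiplies the entries by cube
   roots of unity, which gives sigma its order 6. *)
Require Import Defs.
From mathcomp Require Import all_boot all_order all_algebra.
From mathcomp Require Import complex ring lra.
From mathcomp Require Import all_classical all_reals all_analysis.

Set Implicit Arguments.
Unset Strict Implicit.
Unset Printing Implicit Defensive.

Import Order.TTheory GRing.Theory Num.Theory numFieldNormedType.Exports.

Local Open Scope classical_set_scope.
Local Open Scope ring_scope.
Local Open Scope complex_scope.

Local Notation i0 := (@Ordinal 3 0 isT).
Local Notation i1 := (@Ordinal 3 1 isT).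
Local Notation i2 := (@Ordinal 3 2 isT).

(* Otherwise simplification turns [conjc 0] into [0 -i* 0]. *)
#[local] Arguments conjc : simpl never.
#[local] Arguments real_complex_def : simpl never.

(** * Homogeneous spaces with a common stabilizer *)

(** Along the orbit map of [p], the preimage of [W] under [phi] pulls back to the same subset of
    SU_3 as [W] does along the orbit map of [phi p]. Openness and local smooth extensions therefore
    carry over unchanged. *)
Lemma equivariant_smooth_map (R : realType) (X Y : gspace R)
    (phi : gpoint X -> gpoint Y) :
    (forall g p, SU3 g -> gset X p -> gset X (gact g p)) ->
    (forall p, gset X p -> gset Y (phi p)) -> equivariant X Y phi ->
  smooth_map phi.
Proof.
move=> Xact phiY phiE.
have preE p W : gset X p ->
    orbit_preimage p (gset X `&` phi @^-1` W) = orbit_preimage (phi p) W.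
  move=> Xp; apply/seteqP; split=> [g [SUg [_ Wg]]|g [SUg Wg]].
    by split=> //; rewrite -phiE.
  by split=> //; split; [exact: Xact | rewrite /= phiE].
split=> // [W [_ oW]|W f _ sf].
  split=> [p [] //|p Xp].
  by rewrite preE //; apply/oW/phiY.
move=> p Xp; rewrite preE // => g Ag.
have [V [F [oV Vg sF eF]]] := sf _ (phiY _ Xp) g Ag.
exists V, F; split=> // h Ah Vh.
by have [SUh _] := Ah; rewrite /= phiE //; exact: eF.
Qed.

Lemma same_stabilizer_diffeomorphism (R : realType) (X Y : gspace R)
    (H : set 'M[R[i]]_3) :
    matrix_group (@SU3 R) ->
    represented_as X (@SU3 R) H -> represented_as Y (@SU3 R) H ->
  exists phi, diffeomorphism X Y phi /\ equivariant X Y phi.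
Proof.
move=> [SU1 SUM SUV] [X1 XM [p [Xp orbX stX]]] [Y1 YM [q [Yq orbY stY]]].
have actX g x : SU3 g -> gset X x -> gset X (gact g x).
  move=> SUg; rewrite -orbX => -[h SUh <-].
  by exists (g *m h); [exact: SUM | rewrite XM].
have actY g y : SU3 g -> gset Y y -> gset Y (gact g y).
  move=> SUg; rewrite -orbY => -[h SUh <-].
  by exists (g *m h); [exact: SUM | rewrite YM].
(* The map g.z |-> g.t is built for arbitrary spaces, so that exchanging the roles of [X] and [Y]
   yields its inverse. *)
suff trans_map (Z T : gspace R) z t :
    (forall g z', SU3 g -> gset Z z' -> gset Z (gact g z')) ->
    (forall g t', SU3 g -> gset T t' -> gset T (gact g t')) ->
    (forall z', gset Z z' -> gact 1%:M z' = z') ->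
    (forall t', gset T t' -> gact 1%:M t' = t') ->
    (forall g h z', SU3 g -> SU3 h -> gset Z z' ->
       gact (g *m h) z' = gact g (gact h z')) ->
    (forall g h t', SU3 g -> SU3 h -> gset T t' ->
       gact (g *m h) t' = gact g (gact h t')) ->
    gset Z z -> gset T t -> [set gact g z | g in @SU3 R] = gset Z ->
    [set g | SU3 g /\ gact g z = z] = [set g | SU3 g /\ gact g t = t] ->
    exists2 phi : gpoint Z -> gpoint T,
      smooth_map phi /\ equivariant Z T phi &
      forall g, SU3 g -> phi (gact g z) = gact g t.
  have [phi [phis phie] phiE] :=
    trans_map X Y p q actX actY X1 Y1 XM YM Xp Yq orbX (etrans stX (esym stY)).
  have [psi [psis psie] psiE] :=
    trans_map Y X q p actY actX Y1 X1 YM XM Yq Xp orbY (etrans stY (esym stX)).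
  exists phi; split=> //; split=> //; exists psi; split=> //.
    by move=> x; rewrite -orbX => -[g SUg <-]; rewrite phiE // psiE.
  by move=> y; rewrite -orbY => -[g SUg <-]; rewrite psiE // phiE.
move=> actZ actT Z1 T1 ZM TM Zz Tt orbZ st.
(* Well-definedness: h^-1 g stabilizes z, hence also t. *)
have wd g h : SU3 g -> SU3 h -> gact g z = gact h z -> gact g t = gact h t.
  move=> SUg SUh eqz; have [hu SUh'] := SUV _ SUh.
  have: [set g | SU3 g /\ gact g z = z] (invmx h *m g).
    split; first exact: SUM.
    by rewrite ZM // eqz -ZM // mulVmx // Z1.
  rewrite st => -[_ eqt].
  by rewrite -{2}eqt -TM //; [rewrite mulmxA mulmxV // mul1mx | exact: SUM].
(* Choice needs a total relation on the ambient type; points outside [gset Z] are sent to the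
   default [t]. *)
have /choice[phi phiP] : forall z', exists t', gset Z z' ->
    exists2 g, SU3 g & z' = gact g z /\ t' = gact g t.
  move=> z'; have [Zz'|nZ] := pselect (gset Z z'); last by exists t => /nZ.
  by move: (Zz'); rewrite -orbZ => -[g SUg <-]; exists (gact g t); exists g.
have phiE g : SU3 g -> phi (gact g z) = gact g t.
  move=> SUg; have [h SUh [ez ->]] := phiP _ (actZ _ _ SUg Zz).
  exact/esym/wd.
have phie : equivariant Z T phi.
  move=> g z' SUg; rewrite -orbZ => -[h SUh <-].
  rewrite -ZM // phiE //; last exact: SUM.
  by rewrite phiE // TM.
exists phi => //; split=> //; apply: equivariant_smooth_map => // z'.
by rewrite -orbZ => -[g SUg <-]; rewrite phiE //; exact: actT.
Qed.

(** * Complex 3x3 matrices *)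

Lemma forall_ord3 (P : 'I_3 -> Prop) : P i0 -> P i1 -> P i2 -> forall i, P i.
Proof.
move=> P0 P1 P2 [[|[|[|//]]] h].
- by rewrite (_ : Ordinal h = i0) //; exact: val_inj.
- by rewrite (_ : Ordinal h = i1) //; exact: val_inj.
- by rewrite (_ : Ordinal h = i2) //; exact: val_inj.
Qed.

Lemma sum_ord3 (V : nmodType) (F : 'I_3 -> V) :
  \sum_i F i = F i0 + F i1 + F i2.
Proof.
rewrite !big_ord_recl big_ord0 addr0 addrA.
by congr (_ + _ + _); congr F; exact: val_inj.
Qed.

Lemma matrix3P (V : nmodType) (A B : 'M[V]_3) :
    A i0 i0 = B i0 i0 -> A i0 i1 = B i0 i1 -> A i0 i2 = B i0 i2 ->
    A i1 i0 = B i1 i0 -> A i1 i1 = B i1 i1 -> A i1 i2 = B i1 i2 ->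
    A i2 i0 = B i2 i0 -> A i2 i1 = B i2 i1 -> A i2 i2 = B i2 i2 ->
  A = B.
Proof.
by move=> *; apply/matrixP; apply: forall_ord3; apply: forall_ord3.
Qed.

Lemma colvec3P (V : nmodType) (u v : 'cV[V]_3) :
  u i0 0 = v i0 0 -> u i1 0 = v i1 0 -> u i2 0 = v i2 0 -> u = v.
Proof. by move=> *; apply/colP; apply: forall_ord3. Qed.

Lemma mulmx3E (K : pzSemiRingType) (n p : nat) (A : 'M[K]_(n, 3))
    (B : 'M[K]_(3, p)) i j :
  (A *m B) i j = A i i0 * B i0 j + A i i1 * B i1 j + A i i2 * B i2 j.
Proof. by rewrite mxE sum_ord3. Qed.

Lemma det3E (K : comPzRingType) (A : 'M[K]_3) :
  \det A = A i0 i0 * (A i1 i1 * A i2 i2 - A i1 i2 * A i2 i1)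
         - A i0 i1 * (A i1 i0 * A i2 i2 - A i1 i2 * A i2 i0)
         + A i0 i2 * (A i1 i0 * A i2 i1 - A i1 i1 * A i2 i0).
Proof.
have det2E (B : 'M[K]_2) :
    \det B = B ord0 ord0 * B ord_max ord_max - B ord0 ord_max * B ord_max ord0.
  rewrite (expand_det_row _ ord0) big_ord_recl big_ord1 /cofactor !det_mx11.
  rewrite !mxE /= expr0 mul1r expr1 mulN1r mulrN.
  by congr (_ * B _ _ - B _ _ * B _ _); exact: val_inj.
rewrite (expand_det_row _ ord0) !big_ord_recl big_ord0 addr0 /cofactor !det2E.
rewrite !mxE /= addn0 expr0 mul1r expr1 mulN1r mulrN.
rewrite sqrrN expr1n mul1r addrA.
by do !congr (_ + _); do ?congr (- _);
   do !congr (_ * _); do ?congr (_ - _); do ?congr (_ * _); congr (A _ _);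
   exact: val_inj.
Qed.

Lemma conj_mxM (R : realType) (m n p : nat) (A : 'M[R[i]]_(m, n))
    (B : 'M[R[i]]_(n, p)) : conj_mx (A *m B) = conj_mx A *m conj_mx B.
Proof. exact: map_mxM. Qed.

Lemma conj_mx1 (R : realType) (n : nat) : conj_mx 1%:M = 1%:M :> 'M[R[i]]_n.
Proof. exact: map_mx1. Qed.

Lemma conj_mxK (R : realType) (m n : nat) (A : 'M[R[i]]_(m, n)) :
  conj_mx (conj_mx A) = A.
Proof. by apply/matrixP => i j; rewrite !mxE conjcK. Qed.

Lemma conj_mx_tr (R : realType) (m n : nat) (A : 'M[R[i]]_(m, n)) :
  conj_mx A^T = (conj_mx A)^T.
Proof. by apply/matrixP => i j; rewrite !mxE. Qed.

Lemma conj_mx_inv (R : realType) (n : nat) (A : 'M[R[i]]_n) :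
  conj_mx (invmx A) = invmx (conj_mx A).
Proof. exact: map_invmx. Qed.

Lemma det_conj_mx (R : realType) (n : nat) (A : 'M[R[i]]_n) :
  \det (conj_mx A) = conjc (\det A).
Proof. exact: det_map_mx. Qed.

Lemma conj_mx_complexify (R : realType) (m n : nat) (A : 'M[R]_(m, n)) :
  conj_mx (complexify A) = complexify A.
Proof. by apply/matrixP => i j; rewrite !mxE conjc_real. Qed.

Lemma complexifyM (R : realType) (m n p : nat) (A : 'M[R]_(m, n))
    (B : 'M[R]_(n, p)) :
  complexify (A *m B) = complexify A *m complexify B.
Proof. exact: map_mxM. Qed.

Lemma conjc_mul_normc (R : realType) (a : R[i]) : conjc a * a = `|a| ^+ 2.
Proof. by rewrite normCK mulrC. Qed.

Lemma invmx_mul (K : comUnitRingType) (n : nat) (A B : 'M[K]_n) :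
  A \in unitmx -> B \in unitmx -> invmx (A *m B) = invmx B *m invmx A.
Proof.
move=> uA uB; have uAB : A *m B \in unitmx by rewrite unitmx_mul uA.
rewrite -[RHS]mul1mx -(mulVmx uAB) -[RHS]mulmxA -(mulmxA A) (mulmxA B).
by rewrite mulmxV // mul1mx mulmxV // mulmx1.
Qed.

(** * The groups SL_3, SU_3 and U_1 *)

Lemma SL3_unit (R : realType) (g : 'M[R[i]]_3) : SL3 g -> g \in unitmx.
Proof. by move=> dg; rewrite unitmxE dg unitr1. Qed.

(** The adjugate is polynomial in the entries, so it provides the global holomorphic extensions
    required of tau and sigma. *)
Lemma SL3_invmx_adj (R : realType) (g : 'M[R[i]]_3) : SL3 g -> invmx g = \adj g.
Proof.
by move=> dg; rewrite /invmx (SL3_unit dg) dg invr1 scale1r.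
Qed.

Lemma SL3_group (R : realType) : matrix_group (@SL3 R).
Proof.
split=> [|g h /= dg dh|g dg]; first exact: det1.
  by rewrite /SL3 /= det_mulmx dg dh mulr1.
by split; [exact: SL3_unit | rewrite /SL3 /= det_inv dg invr1].
Qed.

Lemma SU3_SL3 (R : realType) (g : 'M[R[i]]_3) : SU3 g -> SL3 g.
Proof. by case. Qed.

Lemma SU3_unit (R : realType) (g : 'M[R[i]]_3) : SU3 g -> g \in unitmx.
Proof. by move/SU3_SL3/SL3_unit. Qed.

Lemma SU3_invmx (R : realType) (g : 'M[R[i]]_3) :
  SU3 g -> invmx g = (conj_mx g)^T.
Proof.
move=> SUg; have [ug _] := SUg.
by rewrite -[LHS]mul1mx -ug -mulmxA mulmxV ?SU3_unit // mulmx1.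
Qed.

Lemma SU3_group (R : realType) : matrix_group (@SU3 R).
Proof.
split=> [|g h [ug dg] [uh dh]|g SUg].
- by split; [rewrite conj_mx1 trmx1 mulmx1 | exact: det1].
- split; last by rewrite det_mulmx dg dh mulr1.
  by rewrite conj_mxM trmx_mul -mulmxA (mulmxA _ g) ug mul1mx.
have [ug dg] := SUg; split; first exact: SU3_unit.
split; last by rewrite det_inv dg invr1.
rewrite (SU3_invmx SUg) conj_mx_tr.
by rewrite conj_mxK trmxK; apply: mulmx1C.
Qed.

Lemma represented_as_intro (R : realType) (X : gspace R) (p : gpoint X)
    (H : set 'M[R[i]]_3) :
    (forall q, gset X q -> gact 1%:M q = q) ->
    (forall g h q, SU3 g -> SU3 h -> gset X q ->
       gact (g *m h) q = gact g (gact h q)) ->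
    gset X p ->
    (forall q, gset X q <-> exists2 g, SU3 g & gact g p = q) ->
    (forall g, SU3 g /\ gact g p = p <-> H g) ->
  represented_as X (@SU3 R) H.
Proof.
move=> X1 XM Xp orb st; split=> //; exists p; split=> //.
  by apply/seteqP; split=> q /orb.
by apply/seteqP; split=> g /st.
Qed.

(** The last column of g is g e_3 = e_3. The inverse of g, its conjugate transpose, fixes e_3 too,
    which determines the last row. *)
Lemma SU3_fixes_e3_row (R : realType) (g : 'M[R[i]]_3) :
    SU3 g -> g *m delta_mx i2 0 = delta_mx i2 (0 : 'I_1) ->
  [/\ g i0 i2 = 0, g i1 i2 = 0, g i2 i2 = 1, g i2 i0 = 0 & g i2 i1 = 0].
Proof.
move=> SUg; have [ug _] := SUg => ge3.
have colg i : g i i2 = (i == i2)%:R.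
  by have /colP/(_ i) := ge3; rewrite -colE !mxE eqxx andbT.
have rowg : (conj_mx g)^T *m delta_mx i2 0 = delta_mx i2 (0 : 'I_1).
  by rewrite -{1}ge3 mulmxA ug mul1mx.
have g2 j : g i2 j = (j == i2)%:R.
  have /colP/(_ j) := rowg; rewrite -colE !mxE eqxx andbT.
  move=> /(congr1 (@conjc R)).
  by rewrite conjcK conjc_nat.
by split; rewrite ?colg ?g2.
Qed.

(** Common last step of the three stabilizer computations: g is diagonal with last entry 1, the
    determinant makes the first two entries inverse to each other, and unitarity gives them modulus
    1. *)
Lemma U1P (R : realType) (g : 'M[R[i]]_3) :
    SU3 g -> g *m delta_mx i2 0 = delta_mx i2 (0 : 'I_1) ->
    g i0 i1 = 0 -> g i1 i0 = 0 ->
  U1 g.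
Proof.
move=> SUg /(SU3_fixes_e3_row SUg)[g02 g12 g22 g20 g21] g01 g10.
have [ug dg] := SUg.
have gE : g i0 i0 * g i1 i1 = 1.
  by move: dg; rewrite det3E g02 g12 g22 g20 g21 g01 g10 => <-; ring.
have g0 : g i0 i0 != 0.
  by apply/eqP => g00; move/eqP: gE; rewrite g00 mul0r eq_sym oner_eq0.
exists (g i0 i0).
  have /matrixP/(_ i0 i0) := ug; rewrite mulmx3E !mxE g10 g20 !mulr0 !addr0 /=.
  rewrite conjc_mul_normc => /eqP; rewrite sqrf_eq1 => /orP[/eqP//|/eqP nE].
  have := normr_ge0 (g i0 i0); rewrite nE lerNr oppr0 => /le_gtF.
  by rewrite ltr01.
have g11 : (g i0 i0)^-1 = g i1 i1 by rewrite -[LHS]mulr1 -gE mulKf.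
by apply: matrix3P; rewrite !mxE /= ?g11.
Qed.

Lemma U1_SU3 (R : realType) (g : 'M[R[i]]_3) : U1 g -> SU3 g.
Proof.
move=> [a /= na <-].
have a0 : a != 0 by rewrite -normr_eq0 na oner_eq0.
have caa : conjc a * a = 1 by rewrite conjc_mul_normc na expr1n.
have cv : conjc a^-1 * a^-1 = 1.
  by rewrite conjc_mul_normc normfV na invr1 expr1n.
split; last by rewrite det3E !mxE /=; field.
by apply: matrix3P; rewrite mulmx3E !mxE /= ?conjc0 ?conjc1
  ?mul0r ?mulr0 ?add0r ?addr0 ?mulr1 ?caa ?cv.
Qed.

Lemma U1_group (R : realType) : matrix_group (@U1 R).
Proof.
split=> [|_ _ [a /= na <-] [b /= nb <-]|g U1g].
- by exists 1; [exact: normr1 | apply: matrix3P; rewrite !mxE /= ?invr1].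
- exists (a * b); first by rewrite /= normrM na nb mulr1.
  by apply: matrix3P; rewrite [RHS]mulmx3E !mxE /=
    ?invfM ?(mulr0, mul0r, mulr1, addr0, add0r).
have SUg := U1_SU3 U1g; split; first exact: SU3_unit.
rewrite (SU3_invmx SUg); case: U1g => a /= na <-.
have caa : conjc a * a = 1 by rewrite conjc_mul_normc na expr1n.
have a0 : a != 0 by rewrite -normr_eq0 na oner_eq0.
have ca : conjc a = a^-1 by rewrite -[LHS]mulr1 -(mulfV a0) mulrA caa mul1r.
have cVa : conjc a^-1 = a by rewrite -ca conjcK.
exists (conjc a); first by rewrite /= ca normfV na invr1.
by apply: matrix3P; rewrite !mxE /= ?conjc0 ?conjc1 // ?cVa // ca invrK.
Qed.

(** * FL_3 *)

Lemma conjc_epsilon (R : realType) : conjc (epsilon R) * epsilon R = 1.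
Proof.
apply/eqP; rewrite eq_complex /conjc /=.
apply/andP; split; apply/eqP; last by ring.
by rewrite -[RHS](cos2Dsin2 (pi / 3%:R : R)) !expr2; ring.
Qed.

Lemma epsilon3 (R : realType) : epsilon R ^+ 3 = - 1.
Proof.
(* This is e^(it); its addition formula turns the cube of epsilon into the value at pi. *)
pose cis (t : R) : R[i] := cos t +i* sin t.
have cisD s t : cis s * cis t = cis (s + t).
  by rewrite /cis cosD sinD /=; apply/eqP; rewrite eq_complex /=;
    apply/andP; split; apply/eqP; ring.
rewrite 2!exprS expr1 /epsilon -!/(cis _) !cisD.
rewrite (_ : pi / 3 + (pi / 3 + pi / 3) = pi); last by field.
by rewrite /cis cospi sinpi; apply/eqP; rewrite eq_complex /= oppr0 !eqxx.
Qed.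

(** A primitive cube root of unity; the nonzero entries of P are its powers. *)
Definition omega (R : realType) : R[i] := epsilon R ^+ 2.

Lemma omega3 (R : realType) : omega R ^+ 3 = 1.
Proof. by rewrite /omega -exprM mulnC exprM epsilon3 sqrrN expr1n. Qed.

Lemma omega_neq0 (R : realType) : omega R != 0.
Proof.
by apply/eqP => w0; have /eqP := omega3 R; rewrite w0 expr0n eq_sym oner_eq0.
Qed.

(** If epsilon^2 = 1, then epsilon = epsilon^3 = -1, although its real part cos(pi/3) is
    positive. *)
Lemma omega_neq1 (R : realType) : omega R != 1.
Proof.
rewrite /omega; apply/eqP => e2; have := epsilon3 R.
rewrite exprS e2 mulr1 => -[cE _].
have : 0 < cos (pi / 3%:R) :> R.
  apply: cos_gt0_pihalf; rewrite ltr_pdivlMr // ltr_pdivrMr //.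
  have := pi_gt0 R; lra.
by rewrite cE oppr_gt0 ltr10.
Qed.

Lemma conjc_omega (R : realType) : conjc (omega R) = omega R ^+ 2.
Proof.
rewrite -[LHS]mulr1 -(omega3 R) exprS mulrA {1 2}/omega rmorphXn -exprMn.
by rewrite conjc_epsilon expr1n mul1r.
Qed.

Lemma PmxE (R : realType) :
  Pmx R = mx3 [:: [:: 0; omega R; 0]; [:: omega R ^+ 2; 0; 0]; [:: 0; 0; 1]].
Proof. by rewrite /Pmx /omega -exprM. Qed.

Lemma Pmx_involutive (R : realType) : Pmx R *m Pmx R = 1%:M.
Proof.
rewrite PmxE; apply: matrix3P; rewrite mulmx3E !mxE /=;
  rewrite ?(mul0r, mulr0, add0r, addr0, mulr1) //.
- by rewrite -exprS omega3.
- by rewrite -exprSr omega3.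
Qed.

Lemma Pmx_unit (R : realType) : Pmx R \in unitmx.
Proof. by have [] := mulmx1_unit (Pmx_involutive R). Qed.

Lemma invmx_Pmx (R : realType) : invmx (Pmx R) = Pmx R.
Proof.
by rewrite -[LHS]mulmx1 -(Pmx_involutive R) mulmxA mulVmx ?mul1mx ?Pmx_unit.
Qed.

(** Being Hermitian, together with P^2 = 1, is what makes sigma commute with tau. *)
Lemma conj_Pmx_tr (R : realType) : (conj_mx (Pmx R))^T = Pmx R.
Proof.
rewrite PmxE; apply: matrix3P; rewrite !mxE /= ?conjc0 ?conjc1 //.
  rewrite rmorphXn /= conjc_omega -exprM (exprD _ 3 1) omega3 expr1 mul1r //.
exact: conjc_omega.
Qed.

Lemma trPmx_Pmx (R : realType) : (Pmx R)^T *m Pmx R =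
  mx3 [:: [:: omega R; 0; 0]; [:: 0; omega R ^+ 2; 0]; [:: 0; 0; 1]].
Proof.
rewrite PmxE; apply: matrix3P; rewrite mulmx3E !mxE /=;
  rewrite ?(mul0r, mulr0, add0r, addr0, mulr1) ?expr2 //.
by rewrite -!expr2 -exprM (exprD _ 3 1) omega3 mul1r.
Qed.

Lemma Pmx_trPmx (R : realType) : Pmx R *m (Pmx R)^T =
  mx3 [:: [:: omega R ^+ 2; 0; 0]; [:: 0; omega R; 0]; [:: 0; 0; 1]].
Proof.
rewrite PmxE; apply: matrix3P; rewrite mulmx3E !mxE /=;
  rewrite ?(mul0r, mulr0, add0r, addr0, mulr1) ?expr2 //.
by rewrite -!expr2 -exprM (exprD _ 3 1) omega3 mul1r.
Qed.

Lemma SU3_stab_Pmx (R : realType) (g : 'M[R[i]]_3) :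
  SU3 g /\ g *m Pmx R *m g^T = Pmx R <-> U1 g.
Proof.
split=> [[SUg gP]|U1g]; last first.
  split; first exact: U1_SU3.
  case: U1g => a /= na <-.
  have a0 : a != 0 by rewrite -normr_eq0 na oner_eq0.
  rewrite PmxE; apply: matrix3P; rewrite !mulmx3E !mxE /=;
    rewrite ?(mul0r, mulr0, add0r, addr0, mulr1) //.
    by rewrite mulrAC mulfV ?mul1r.
  by rewrite mulrAC mulVf ?mul1r.
have ug := SU3_unit SUg; have ugT : g^T \in unitmx by rewrite unitmx_tr.
(* Transposing g P g^T = P shows that g also stabilizes P^T; the two relations combine to let g
   commute with P^T P. *)
have gPT : g *m (Pmx R)^T *m g^T = (Pmx R)^T.
  by rewrite -{2}gP !trmx_mul trmxK mulmxA.
have comm : g *m ((Pmx R)^T *m Pmx R) = ((Pmx R)^T *m Pmx R) *m g.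
  have e1 : g *m Pmx R = Pmx R *m invmx g^T.
    by rewrite -{2}gP -mulmxA mulmxV // mulmx1.
  have e2 : g *m (Pmx R)^T = (Pmx R)^T *m invmx g^T.
    by rewrite -{2}gPT -mulmxA mulmxV // mulmx1.
  have e3 : invmx g^T = Pmx R *m g *m Pmx R.
    by rewrite -[RHS]mulmxA e1 mulmxA Pmx_involutive mul1mx.
  by rewrite mulmxA e2 e3 -!mulmxA Pmx_involutive mulmx1.
have w0 := omega_neq0 R; have w1 := omega_neq1 R.
have w2 : omega R ^+ 2 - omega R != 0.
  by rewrite expr2 -{3}[omega R]mulr1 -mulrBr mulf_neq0 // subr_eq0.
have w21 : omega R ^+ 2 - 1 != 0.
  rewrite subr_eq0; apply/eqP => e; have := omega3 R.
  by rewrite exprS e mulr1; apply/eqP.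
have w1' : omega R - 1 != 0 by rewrite subr_eq0.
(* A matrix commuting with a diagonal one vanishes at each position where the two diagonal entries
   involved differ. *)
have offdiag i j (c d : R[i]) :
    c - d != 0 -> g i j * c = d * g i j -> g i j = 0.
  move=> cd e; apply: (mulIf cd); rewrite mul0r mulrBr e; ring.
have opp (c d : R[i]) : c - d != 0 -> d - c != 0 by rewrite -opprB oppr_eq0.
rewrite trPmx_Pmx in comm.
have commE i j := congr1 (fun A : 'M[R[i]]_3 => A i j) comm.
have g01 : g i0 i1 = 0.
  have := commE i0 i1; rewrite !mulmx3E !mxE /= ?(mul0r, mulr0, add0r, addr0).
  exact: offdiag.
have g02 : g i0 i2 = 0.
  have := commE i0 i2; rewrite !mulmx3E !mxE /= ?(mul0r, mulr0, add0r, addr0).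
  exact/offdiag/opp.
have g10 : g i1 i0 = 0.
  have := commE i1 i0; rewrite !mulmx3E !mxE /= ?(mul0r, mulr0, add0r, addr0).
  exact/offdiag/opp.
have g12 : g i1 i2 = 0.
  have := commE i1 i2; rewrite !mulmx3E !mxE /= ?(mul0r, mulr0, add0r, addr0).
  exact/offdiag/opp.
(* The (0,1) entry of g P g^T = P is g_00 omega g_11 = omega; the determinant then gives g_22 =
   1. *)
have g01E : g i0 i0 * g i1 i1 = 1.
  have := congr1 (fun A : 'M[R[i]]_3 => A i0 i1) gP.
  rewrite PmxE !mulmx3E !mxE /= g01 g02 g12 ?(mul0r, mulr0, add0r, addr0) => e.
  by apply: (mulfI w0); rewrite mulr1 -[RHS]e; ring.
have g22 : g i2 i2 = 1.
  have [_] := SUg; rewrite det3E g01 g02 g10 g12 => <-.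
  by rewrite -[LHS]mul1r -g01E; ring.
apply: U1P => //; rewrite -colE.
by apply: colvec3P; rewrite !mxE.
Qed.

Lemma represented_as_FL3 (R : realType) :
  represented_as (FL3 R) (@SU3 R) (@U1 R).
Proof.
apply: (@represented_as_intro R (FL3 R) (Pmx R)) => /=.
- by move=> q _; rewrite mul1mx trmx1 mulmx1.
- by move=> g h q _ _ _; rewrite trmx_mul !mulmxA.
- exists 1%:M; first by case: (SU3_group R).
  by rewrite mul1mx trmx1 mulmx1.
- by move=> q; split.
- exact: SU3_stab_Pmx.
Qed.

(** * FL_1 *)

Lemma sphere5E (R : realType) (v : 'cV[R[i]]_3) :
  sphere5 v <-> (conj_mx v)^T *m v = 1%:M.
Proof.
have -> : (conj_mx v)^T *m v = (\sum_i `|v i 0| ^+ 2)%:M.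
  apply/matrixP => i j; rewrite !ord1 !mxE mulr1n.
  by apply: eq_bigr => k _; rewrite !mxE conjc_mul_normc.
rewrite /sphere5 /=; split=> [-> //|/matrixP/(_ 0 0)].
by rewrite !mxE !mulr1n.
Qed.

Lemma e3_sphere5 (R : realType) : sphere5 (delta_mx i2 0 : 'cV[R[i]]_3).
Proof.
by rewrite /sphere5 /= sum_ord3 !mxE /= normr0 normr1 expr0n expr1n !add0r.
Qed.

Lemma SU3_sphere5 (R : realType) (g : 'M[R[i]]_3) (v : 'cV[R[i]]_3) :
  SU3 g -> sphere5 v -> sphere5 (g *m v).
Proof.
move=> [ug _] /sphere5E uv; apply/sphere5E.
by rewrite conj_mxM trmx_mul -mulmxA (mulmxA _ g) ug mul1mx.
Qed.

(** * Oriented subspaces spanned by frames *)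

Lemma act_oriented_span (R : realType) (g F : 'M[R[i]]_3) :
  act_oriented g (oriented_span F) = oriented_span (g *m F).
Proof.
congr (_, _); apply/seteqP; split.
- by move=> _ [_ [x _ <-] <-]; exists x; rewrite ?mulmxA.
- by move=> _ [x _ <-]; exists (F *m complexify x); [exists x | rewrite mulmxA].
- by move=> _ [_ [A dA <-] <-]; exists A; rewrite ?mulmxA.
- by move=> _ [A dA <-]; exists (F *m complexify A);
    [exists A | rewrite mulmxA].
Qed.

(** Left multiplication by A is a bijection of the real coordinate vectors and of the matrices of
    positive determinant, with inverse given by A^-1. *)
Lemma oriented_span_mulr (R : realType) (F : 'M[R[i]]_3) (A : 'M[R]_3) :
  0 < \det A -> oriented_span (F *m complexify A) = oriented_span F.
Proof.
move=> dA; have uA : A \in unitmx by rewrite unitmxE unitfE gt_eqF.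
have AK (n : nat) (B : 'M[R]_(3, n)) :
    F *m complexify A *m complexify (invmx A *m B) = F *m complexify B.
  by rewrite -mulmxA -complexifyM mulKVmx.
congr (_, _); apply/seteqP; split.
- by move=> _ [x _ <-]; exists (A *m x); rewrite // complexifyM mulmxA.
- by move=> _ [x _ <-]; exists (invmx A *m x); rewrite ?AK.
- move=> _ [B /= dB <-]; exists (A *m B); last by rewrite complexifyM mulmxA.
  by rewrite /= det_mulmx mulr_gt0.
- move=> _ [B /= dB <-]; exists (invmx A *m B); last by rewrite AK.
  by rewrite /= det_mulmx det_inv mulr_gt0 // invr_gt0.
Qed.

Lemma act_oriented1 (R : realType) (V : oriented_subspace R) :
  act_oriented 1%:M V = V.
Proof.
case: V => V B; congr (_, _); apply/seteqP; split.
- by move=> _ [v Vv <-]; rewrite mul1mx.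
- by move=> v Vv; exists v; rewrite ?mul1mx.
- by move=> _ [v Vv <-]; rewrite mul1mx.
- by move=> v Vv; exists v; rewrite ?mul1mx.
Qed.

Lemma act_orientedM (R : realType) (g h : 'M[R[i]]_3)
    (V : oriented_subspace R) :
  act_oriented (g *m h) V = act_oriented g (act_oriented h V).
Proof.
case: V => V B; congr (_, _); apply/seteqP; split.
- by move=> _ [v Vv <-]; exists (h *m v); [exists v | rewrite mulmxA].
- by move=> _ [_ [v Vv <-] <-]; exists v; rewrite ?mulmxA.
- by move=> _ [v Vv <-]; exists (h *m v); [exists v | rewrite mulmxA].
- by move=> _ [_ [v Vv <-] <-]; exists v; rewrite ?mulmxA.
Qed.

Lemma complexify1 (R : realType) (n : nat) :
  complexify 1%:M = 1%:M :> 'M[R[i]]_n.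
Proof. exact: map_mx1. Qed.

Lemma complexify_delta (R : realType) (m n : nat) (k : 'I_m) (l : 'I_n) :
  complexify (delta_mx k l : 'M[R]_(m, n)) = delta_mx k l.
Proof. by apply/matrixP => i j; rewrite !mxE rmorph_nat. Qed.

Lemma complexify_tr (R : realType) (m n : nat) (A : 'M[R]_(m, n)) :
  complexify A^T = (complexify A)^T.
Proof. by apply/matrixP => i j; rewrite !mxE. Qed.

Lemma complexify_inj (R : realType) (m n : nat) :
  injective (@complexify R m n).
Proof.
by move=> A B /matrixP eAB; apply/matrixP => i j;
  have := eAB i j; rewrite !mxE => /complexI.
Qed.

(** Repeats the matrix inside [V0], so that [V0] is convertible to its oriented span. *)
Definition frame0 (R : realType) : 'M[R[i]]_3 :=
  mx3 [:: [:: 2^-1 +i* 2^-1; 2^-1 -i* 2^-1; 0];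
          [:: 2^-1 -i* 2^-1; 2^-1 +i* 2^-1; 0];
          [:: 0; 0; 1]].

Lemma frame0_unitary (R : realType) :
  (conj_mx (frame0 R))^T *m frame0 R = 1%:M.
Proof.
by apply: matrix3P; rewrite mulmx3E !mxE /= ?conjc0 ?conjc1
  ?(mul0r, mulr0, add0r, addr0, mulr1) //; apply/eqP;
  rewrite eq_complex /conjc /=; apply/andP; split; apply/eqP; field.
Qed.

Lemma frame0_unitaryC (R : realType) :
  frame0 R *m (conj_mx (frame0 R))^T = 1%:M.
Proof. exact/mulmx1C/frame0_unitary. Qed.

(** For a unitary frame F, the matrix F F^T depends only on the real span, since F A (F A)^T = F F^T
    for A real orthogonal. This invariant of V_0 serves to compute its stabilizer. *)
Lemma frame0_mul_tr (R : realType) :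
  frame0 R *m (frame0 R)^T = mx3 [:: [:: 0; 1; 0]; [:: 1; 0; 0]; [:: 0; 0; 1]].
Proof.
by apply: matrix3P; rewrite mulmx3E !mxE /=
  ?(mul0r, mulr0, add0r, addr0, mulr1) //; apply/eqP;
  rewrite eq_complex /=; apply/andP; split; apply/eqP; field.
Qed.

Lemma frame0_e3 (R : realType) :
  frame0 R *m delta_mx i2 0 = delta_mx i2 (0 : 'I_1).
Proof. by rewrite -colE; apply: colvec3P; rewrite !mxE. Qed.

Lemma frame0_adj_e3 (R : realType) :
  (conj_mx (frame0 R))^T *m delta_mx i2 0 = delta_mx i2 (0 : 'I_1).
Proof. by rewrite -{1}frame0_e3 mulmxA frame0_unitary mul1mx. Qed.

(** For F unitary and x, y real, the Hermitian product of F x and F y is that of x and y, hence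
    real. *)
Lemma unitary_lagrangian (R : realType) (F : 'M[R[i]]_3) :
  (conj_mx F)^T *m F = 1%:M -> oriented_lagrangian (oriented_span F).
Proof.
move=> uF; exists F; split=> //.
  move=> x Fx; apply: complexify_inj; rewrite -[LHS]mul1mx -uF -mulmxA Fx.
  by rewrite mulmx0; apply/matrixP => i j; rewrite !mxE.
move=> _ _ [x _ <-] [y _ <-]; rewrite /symplectic_form.
set u := F *m _; set v := F *m _.
have -> : \sum_i u i 0 * conjc (v i 0) = ((conj_mx v)^T *m u) 0 0.
  by rewrite mxE; apply: eq_bigr => i _; rewrite !mxE mulrC.
rewrite conj_mxM trmx_mul -mulmxA (mulmxA _ F) uF mul1mx conj_mx_complexify.
by rewrite -complexify_tr -complexifyM mxE.
Qed.

(* Twice the orthogonal projection onto the line of e3 + x, minus the identity,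
   except for x = - e3. *)
Lemma rotation_e3 (R : realType) (x : 'cV[R]_3) : x^T *m x = 1%:M ->
  exists A : 'M[R]_3,
    [/\ A^T *m A = 1%:M, \det A = 1 & A *m delta_mx i2 0 = x].
Proof.
move=> /matrixP/(_ 0 0); rewrite mulmx3E !mxE mulr1n.
have [x2 xx|x2 xx] := eqVneq (x i2 0) (- 1).
  have [x0 x1] : x i0 0 = 0 /\ x i1 0 = 0.
    have : x i0 0 ^+ 2 + x i1 0 ^+ 2 = 0.
      by rewrite !expr2; move: xx; rewrite x2; lra.
    move/eqP; rewrite paddr_eq0 ?sqr_ge0 // !sqrf_eq0.
    by move=> /andP[/eqP-> /eqP->].
  (* Here x = - e_3, and the half-turn about the first axis serves. *)
  exists (mx3 [:: [:: 1; 0; 0]; [:: 0; - 1; 0]; [:: 0; 0; - 1]]); split.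
  - by apply: matrix3P; rewrite mulmx3E !mxE /=; ring.
  - by rewrite det3E !mxE /=; ring.
  - by rewrite -colE; apply: colvec3P; rewrite !mxE /= ?x0 ?x1 ?x2.
have c0 : 1 + x i2 0 != 0 by rewrite addrC -[1]opprK subr_eq0.
pose w := delta_mx i2 0 + x; pose c := (1 + x i2 0)^-1.
(* As x is a unit vector, the squared norm of e_3 + x is 2 (1 + x_2); so c w w^T is twice the
   projection onto the line of w. *)
have ww : c * (w i0 0 * w i0 0 + w i1 0 * w i1 0 + w i2 0 * w i2 0) = 2.
  rewrite /w !mxE /= !add0r; apply: (mulfI c0); rewrite /c mulrA mulfV // mul1r.
  by move: xx; lra.
pose A : 'M[R]_3 := c *: (w *m w^T) - 1%:M.
have AE i j : A i j = c * (w i 0 * w j 0) - (i == j)%:R.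
  by rewrite !mxE big_ord1 !mxE.
have AT : A^T = A.
  by apply/matrixP => i j; rewrite mxE !AE (mulrC (w j 0)) eq_sym.
exists A; split.
- rewrite AT; apply/matrixP => i j; rewrite mulmx3E !AE.
  transitivity ((i == j)%:R + c * (w i 0 * w j 0) *
    (c * (w i0 0 * w i0 0 + w i1 0 * w i1 0 + w i2 0 * w i2 0) - 2)).
    by move: i j; apply: forall_ord3; apply: forall_ord3 => /=; ring.
  by rewrite ww subrr mulr0 addr0 mxE.
- rewrite det3E !AE /=.
  (* The eigenvalues of A are c |w|^2 - 1 on the line of w and -1 twice on its orthogonal
     complement. *)
  transitivity (c * (w i0 0 * w i0 0 + w i1 0 * w i1 0 + w i2 0 * w i2 0) - 1).
    by ring.
  by rewrite ww; ring.
rewrite -colE; apply: colvec3P; rewrite mxE AE /w !mxE /= /c.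
all: by rewrite ?add0r ?subr0; field.
Qed.

(** For transitivity, some g in SU_3 carries V_0 to V, and a rotation inside V_0 corrects g so that
    e_3 goes to v. *)
Lemma SU3_orbit_FL1 (R : realType) (q : gpoint (FL1 R)) :
  gset (FL1 R) q <->
  exists2 g, SU3 g & gact g ((delta_mx i2 0, V0 R) : gpoint (FL1 R)) = q.
Proof.
have uF := frame0_unitary R; have uF' := frame0_unitaryC R.
split=> [|[g SUg <-]]; last first.
  have [ug _] := SUg; split.
  - exact/SU3_sphere5/e3_sphere5.
  - exists (delta_mx i2 0) => //; exists (delta_mx i2 0) => //.
    by rewrite complexify_delta frame0_e3.
  - split; last by exists g.
    rewrite /= act_oriented_span; apply: unitary_lagrangian.
    by rewrite conj_mxM trmx_mul -mulmxA (mulmxA _ g) ug mul1mx.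
case: q => v V /= [/sphere5E uv Vv [_ [g SUg eV]]].
have [ug dg] := SUg.
move: Vv; rewrite {}eV act_oriented_span => -[x _ vE].
have xx : x^T *m x = 1%:M.
  apply: complexify_inj; rewrite complexifyM complexify1 -uv -vE conj_mxM.
  rewrite trmx_mul -[RHS]mulmxA (mulmxA _ (g *m _)) conj_mxM trmx_mul.
  rewrite -(mulmxA _ _ (g *m _)) (mulmxA _ g) ug mul1mx uF mul1mx.
  by rewrite conj_mx_complexify complexify_tr.
have [A [uA dA Ae3]] := rotation_e3 xx.
(* Before g, the rotation A is applied in the frame F of V_0. Thus h F = g F A spans V with the same
   orientation, and since F fixes e_3, h e_3 = g F A e_3 = g F x = v. *)
pose h := g *m frame0 R *m complexify A *m (conj_mx (frame0 R))^T.
have hF : h *m frame0 R = g *m frame0 R *m complexify A.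
  by rewrite -[LHS]mulmxA uF mulmx1.
exists h.
  split; last first.
    rewrite !det_mulmx dg mul1r mulrAC -det_mulmx uF' det1 mul1r.
    by rewrite det_map_mx dA.
  rewrite /h !conj_mxM !trmx_mul conj_mx_tr conj_mxK trmxK conj_mx_complexify.
  rewrite -!mulmxA (mulmxA _ g) ug mul1mx (mulmxA _ (frame0 R)) uF mul1mx.
  rewrite (mulmxA (complexify A)^T) -complexify_tr -complexifyM uA complexify1.
  by rewrite mul1mx uF'.
congr (_, _).
  rewrite -[h *m _]mulmxA frame0_adj_e3 -mulmxA -complexify_delta -complexifyM.
  by rewrite Ae3.
by rewrite act_oriented_span hF oriented_span_mulr // dA.
Qed.

Lemma SU3_stab_FL1 (R : realType) (g : 'M[R[i]]_3) :
  SU3 g /\ gact g ((delta_mx i2 0, V0 R) : gpoint (FL1 R)) =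
           (delta_mx i2 0, V0 R) <-> U1 g.
Proof.
have uF := frame0_unitary R; have uF' := frame0_unitaryC R.
split=> [[SUg gp]|U1g]; last first.
  have SUg := U1_SU3 U1g; split=> //; case: U1g => -[x y] /= na <-.
  have xy : x * x + y * y = 1.
    have /eqP := conjc_mul_normc (x +i* y); rewrite na expr1n eq_complex /=.
    by move=> /andP[/eqP e _]; rewrite -[RHS]e; ring.
  have aV : (x +i* y)^-1 = x -i* y.
    have a0 : x +i* y != 0 by rewrite -normr_eq0 na oner_eq0.
    apply: (mulIf a0); rewrite mulVf //; apply/esym.
    by rewrite -[RHS](expr1n _ 2) -na -conjc_mul_normc.
  congr (_, _).
    by rewrite -colE; apply: colvec3P; rewrite !mxE.
  (* For a = x + iy, diag(a, a^-1, 1) acts on the frame of V_0 by this real rotation. *)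
  pose A : 'M[R]_3 := mx3 [:: [:: x; y; 0]; [:: - y; x; 0]; [:: 0; 0; 1]].
  have dA : \det A = 1 by rewrite -[RHS]xy det3E !mxE /=; ring.
  rewrite [LHS](act_oriented_span _ (frame0 R)).
  rewrite -[RHS](@oriented_span_mulr _ (frame0 R) A) ?dA //.
  congr oriented_span; apply: matrix3P;
    rewrite [LHS]mulmx3E [RHS]mulmx3E !mxE /=
    ?aV ?(rmorph0, rmorph1) ?(mul0r, mulr0, add0r, addr0, mulr1) //;
    apply/eqP; rewrite /real_complex_def eq_complex /=;
    by apply/andP; split; apply/eqP; field.
have [ug dg] := SUg.
have ge3 : g *m delta_mx i2 0 = delta_mx i2 0 := congr1 fst gp.
have gFin : real_span (g *m frame0 R) = real_span (frame0 R).
  have : act_oriented g (oriented_span (frame0 R)) = oriented_span (frame0 R).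
    by have := congr1 snd gp.
  by rewrite act_oriented_span => -[].
(* The columns of g F lie in the real span of F, so their coordinates form a real matrix A with g F
   = F A. *)
have /choice[x xP] : forall j, exists x : 'cV[R]_3,
    frame0 R *m complexify x = g *m frame0 R *m delta_mx j 0.
  move=> j; have : real_span (g *m frame0 R) (g *m frame0 R *m delta_mx j 0).
    by exists (delta_mx j 0); rewrite // complexify_delta.
  by rewrite gFin => -[x _ <-]; exists x.
pose A : 'M[R]_3 := \matrix_(i, j) x j i 0.
have FA : frame0 R *m complexify A = g *m frame0 R.
  apply/matrixP => i j; have /colP/(_ i) := xP j; rewrite -colE mxE.
  by rewrite [X in _ = X -> _]mxE => <-; rewrite mxE;
    apply: eq_bigr => k _; rewrite !mxE.
(* A is unitary as a product of unitary matrices, and real, hence orthogonal; so g preserves F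
   F^T. *)
have AA : complexify A *m (complexify A)^T = 1%:M.
  apply: mulmx1C; rewrite -{1}conj_mx_complexify.
  have -> : complexify A = (conj_mx (frame0 R))^T *m (g *m frame0 R).
    by rewrite -FA mulmxA uF mul1mx.
  rewrite conj_mxM trmx_mul conj_mx_tr conj_mxK trmxK -mulmxA.
  rewrite (mulmxA (frame0 R)).
  by rewrite uF' mul1mx conj_mxM trmx_mul -mulmxA (mulmxA _ g) ug mul1mx.
have gS : g *m (frame0 R *m (frame0 R)^T) *m g^T = frame0 R *m (frame0 R)^T.
  rewrite mulmxA -mulmxA -trmx_mul -FA trmx_mul -mulmxA (mulmxA (complexify A)).
  by rewrite AA mul1mx.
have [g02 g12 g22 g20 g21] := SU3_fixes_e3_row SUg ge3.
have gSE i j := congr1 (fun A : 'M[R[i]]_3 => A i j) gS.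
move: (gSE i0 i0) (gSE i1 i1) (gSE i0 i1).
rewrite frame0_mul_tr !mulmx3E !mxE /= g02 g12.
rewrite ?(mul0r, mulr0, add0r, addr0, mulr1) => e00 e11 e01.
have dg' : g i0 i0 * g i1 i1 - g i0 i1 * g i1 i0 = 1.
  by move: dg; rewrite det3E g02 g12 g22 g20 g21 => <-; ring.
have two0 : (2 : R[i]) != 0 by rewrite pnatr_eq0.
(* Adding g_00 g_11 + g_01 g_10 = 1 to the determinant relation gives 2 g_00 g_11 = 2. The relations
   2 g_00 g_01 = 0 and 2 g_10 g_11 = 0 then kill the off-diagonal entries. *)
have gE : g i0 i0 * g i1 i1 = 1.
  apply: (mulfI two0); rewrite mulr1.
  transitivity ((g i0 i1 * g i1 i0 + g i0 i0 * g i1 i1) +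
                (g i0 i0 * g i1 i1 - g i0 i1 * g i1 i0)); first by ring.
  by rewrite e01 dg'.
apply: U1P => //.
- have : 2 * (g i0 i0 * g i0 i1) = 0 by rewrite -[RHS]e00; ring.
  move/eqP; rewrite !mulf_eq0 (negPf two0) /= => /orP[/eqP g00|/eqP//].
  by move/eqP: gE; rewrite g00 mul0r eq_sym oner_eq0.
- have : 2 * (g i1 i0 * g i1 i1) = 0 by rewrite -[RHS]e11; ring.
  move/eqP; rewrite !mulf_eq0 (negPf two0) /= => /orP[/eqP//|/eqP g11].
  by move/eqP: gE; rewrite g11 mulr0 eq_sym oner_eq0.
Qed.

Lemma represented_as_FL1 (R : realType) :
  represented_as (FL1 R) (@SU3 R) (@U1 R).
Proof.
apply: (@represented_as_intro R (FL1 R)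
  ((delta_mx i2 0, V0 R) : gpoint (FL1 R))).
- by move=> [v V] _; rewrite /= mul1mx act_oriented1.
- by move=> g h [v V] _ _ _; rewrite /= mulmxA act_orientedM.
- apply/SU3_orbit_FL1; exists 1%:M; first by case: (SU3_group R).
  by rewrite /= mul1mx act_oriented1.
- exact: SU3_orbit_FL1.
- exact: SU3_stab_FL1.
Qed.

(** * FL_2 *)

(** One Gram-Schmidt step, applied to a vector of W off the line of w, which exists by dimension. *)
Lemma exists_sphere5_orthogonal (R : realType) (w : 'cV[R[i]]_3)
    (W : {vspace 'cV[R[i]]_3}) :
    sphere5 w -> w \in W -> (1 < \dim W)%N ->
  exists u, [/\ u \in W, sphere5 u & (conj_mx w)^T *m u = 0].
Proof.
move=> /sphere5E ww Ww dW.
have [z Wz wz] : exists2 z, z \in W & z \notin <[w]>%VS.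
  apply/subvPn; apply/negP => /dimvS; rewrite leqNgt => /negP; apply.
  by apply: leq_ltn_trans dW; rewrite dim_vline leq_b1.
pose c := ((conj_mx w)^T *m z) 0 0.
pose u := z - c *: w.
have u0 : u != 0.
  rewrite subr_eq0; apply: contraNneq wz => ->.
  by rewrite memvZ // memv_line.
have wu : (conj_mx w)^T *m u = 0.
  by rewrite mulmxBr -scalemxAr ww [X in X - _]mx11_scalar -/c scalemx1 subrr.
pose n := \sum_i `|u i 0| ^+ 2.
have n0 : n != 0.
  apply: contra u0 => /eqP/psumr_eq0P u0; apply/eqP/colP => i; rewrite [RHS]mxE.
  by apply/eqP; rewrite -normr_eq0 -sqrf_eq0 u0.
have n_ge0 : 0 <= n by apply: sumr_ge0 => i _; exact: exprn_ge0.
exists ((sqrtC n)^-1 *: u); split.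
- by rewrite memvZ // memvB // memvZ.
- rewrite /sphere5 /=; transitivity ((sqrtC n ^+ 2)^-1 * n).
    rewrite mulr_sumr; apply: eq_bigr => i _.
    rewrite mxE normrM normfV (ger0_norm (x := sqrtC n)) ?sqrtC_ge0 //.
    by rewrite exprMn exprVn.
  by rewrite sqrtCK mulVf.
- by rewrite -scalemxAr wu scaler0.
Qed.

(** The missing middle column is the conjugate of the cross product t = w x u: it is orthogonal to u
    and w, and the determinant becomes |t|^2. *)
Lemma SU3_completion (R : realType) (u w : 'cV[R[i]]_3) :
    sphere5 u -> sphere5 w -> (conj_mx w)^T *m u = 0 ->
  exists g, [/\ SU3 g, g *m delta_mx i0 0 = u & g *m delta_mx i2 0 = w].
Proof.
move=> /sphere5E/matrixP/(_ 0 0) uu /sphere5E/matrixP/(_ 0 0) ww.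
move=> /matrixP/(_ 0 0) wu.
move: uu ww wu; rewrite !mulmx3E !mxE mulr1n => uu ww wu.
have uw := congr1 (@conjc R) wu.
move: uw; rewrite conjc0 !(rmorphD, rmorphM) /= !conjcK => uw.
pose t0 := w i1 0 * u i2 0 - w i2 0 * u i1 0.
pose t1 := w i2 0 * u i0 0 - w i0 0 * u i2 0.
pose t2 := w i0 0 * u i1 0 - w i1 0 * u i0 0.
have ct0 : conjc t0 =
    conjc (w i1 0) * conjc (u i2 0) - conjc (w i2 0) * conjc (u i1 0).
  by rewrite rmorphB !rmorphM.
have ct1 : conjc t1 =
    conjc (w i2 0) * conjc (u i0 0) - conjc (w i0 0) * conjc (u i2 0).
  by rewrite rmorphB !rmorphM.
have ct2 : conjc t2 =
    conjc (w i0 0) * conjc (u i1 0) - conjc (w i1 0) * conjc (u i0 0).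
  by rewrite rmorphB !rmorphM.
have tt : t0 * conjc t0 + t1 * conjc t1 + t2 * conjc t2 = 1.
  rewrite ct0 ct1 ct2 /t0 /t1 /t2.
  (* Lagrange's identity: |w x u|^2 is |u|^2 |w|^2 minus the squared modulus of the Hermitian
     product of u and w. *)
  transitivity (
    (conjc (u i0 0) * u i0 0 + conjc (u i1 0) * u i1 0 +
     conjc (u i2 0) * u i2 0) *
    (conjc (w i0 0) * w i0 0 + conjc (w i1 0) * w i1 0 +
     conjc (w i2 0) * w i2 0) -
    (conjc (w i0 0) * u i0 0 + conjc (w i1 0) * u i1 0 +
     conjc (w i2 0) * u i2 0) *
    (w i0 0 * conjc (u i0 0) + w i1 0 * conjc (u i1 0) +
     w i2 0 * conjc (u i2 0))).
    by ring.
  by rewrite uu ww wu mul0r subr0 mulr1.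
exists (mx3 [:: [:: u i0 0; conjc t0; w i0 0]; [:: u i1 0; conjc t1; w i1 0];
               [:: u i2 0; conjc t2; w i2 0]]); split.
- split.
    apply: matrix3P; rewrite mulmx3E !mxE /= ?conjcK // ?ct0 ?ct1 ?ct2.
    + by ring.
    + by rewrite -[RHS]uw; ring.
    + by rewrite /t0 /t1 /t2; ring.
    + by rewrite /t0 /t1 /t2; ring.
    + by ring.
  rewrite det3E !mxE /= -[RHS]tt /t0 /t1 /t2; ring.
- by rewrite -colE; apply: colvec3P; rewrite !mxE.
- by rewrite -colE; apply: colvec3P; rewrite !mxE.
Qed.

(** * The action on flags *)

Lemma lker0_mulmx (R : realType) (g : 'M[R[i]]_3) :
  g \in unitmx -> lker (linfun (mulmx g) : 'End('cV[R[i]]_3)) == 0%VS.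
Proof.
move=> ug; apply/lker0P => u v; rewrite !lfunE /= => e.
by rewrite -(mulKmx ug u) e mulKmx.
Qed.

Lemma dim_mulmx (R : realType) (g : 'M[R[i]]_3) (U : {vspace 'cV[R[i]]_3}) :
  g \in unitmx -> \dim (linfun (mulmx g) @: U)%VS = \dim U.
Proof.
by move=> ug; apply: limg_dim_eq; rewrite (eqP (lker0_mulmx ug)) capv0.
Qed.

Lemma act_flag1 (R : realType) (W : flag3 R) : act_flag 1%:M W = W.
Proof.
case: W => [[W1 W2] W3] /=.
have -> : linfun (mulmx 1%:M) = \1%VF :> 'End('cV[R[i]]_3).
  by apply/lfunP => v; rewrite lfunE /= mul1mx id_lfunE.
by rewrite !lim1g.
Qed.

Lemma act_flagM (R : realType) (g h : 'M[R[i]]_3) (W : flag3 R) :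
  act_flag (g *m h) W = act_flag g (act_flag h W).
Proof.
case: W => [[W1 W2] W3] /=.
have -> : linfun (mulmx (g *m h)) =
    ((linfun (mulmx g) : 'End('cV[R[i]]_3)) \o
     (linfun (mulmx h) : 'End('cV[R[i]]_3)))%VF.
  by apply/lfunP => v; rewrite comp_lfunE !lfunE /= mulmxA.
by rewrite !limg_comp.
Qed.

Definition flag0 (R : realType) : flag3 R :=
  (<[(delta_mx i2 0)%R]>, <[(delta_mx i2 0)%R]> + <[(delta_mx i0 0)%R]>,
   fullv)%VS.

Lemma flag0_full (R : realType) : full_flag (flag0 R).
Proof.
have d3 : \dim <[(delta_mx i2 0)%R : 'cV[R[i]]_3]>%VS = 1%N.
  rewrite dim_vline; case: eqP => // /colP/(_ i2).
  by rewrite !mxE /= => /eqP; rewrite oner_eq0.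
have d1 : \dim <[(delta_mx i0 0)%R : 'cV[R[i]]_3]>%VS = 1%N.
  rewrite dim_vline; case: eqP => // /colP/(_ i0).
  by rewrite !mxE /= => /eqP; rewrite oner_eq0.
split=> //; first by split=> //; [exact: addvSl | exact: subvf].
  (* The two lines meet only in 0: in k e_3 = l e_1 the last coordinate gives k = 0. *)
  rewrite dimv_disjoint_sum ?d3 ?d1 //; apply/eqP; rewrite -subv0.
  apply/subvP => v /memv_capP[/vlineP[k ->] /vlineP[l /colP/(_ i2)]].
  by rewrite !mxE /= mulr0 mulr1 => ->; rewrite scale0r mem0v.
by rewrite dimvf dim_matrix.
Qed.

Lemma act_flag_full (R : realType) (g : 'M[R[i]]_3) (W : flag3 R) :
  g \in unitmx -> full_flag W -> full_flag (act_flag g W).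
Proof.
case: W => [[W1 W2] W3] ug [[W12 W23 ->] d1 d2 d3].
split; rewrite ?dim_mulmx //.
by split; [exact: limgS | exact/limgS/subvf | exact/lker0_limgf/lker0_mulmx].
Qed.

(** For transitivity, a unit vector u of W_2 orthogonal to w yields g in SU_3 with g e_1 = u and g
    e_3 = w. The image of the middle space lies in W_2 and equals it by dimension. *)
Lemma SU3_orbit_FL2 (R : realType) (q : gpoint (FL2 R)) :
  gset (FL2 R) q <->
  exists2 g, SU3 g & gact g ((delta_mx i2 0, flag0 R) : gpoint (FL2 R)) = q.
Proof.
split=> [|[g SUg <-]]; last first.
  split; first exact/SU3_sphere5/e3_sphere5.
    by apply: act_flag_full; [exact: SU3_unit | exact: flag0_full].
  by rewrite /= limg_line lfunE.
case: q => w [[W1 W2] W3] /= [Sw [[W12 W23 ->] d1 d2 d3] W1E].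
have W2w : w \in W2 by apply: (subvP W12); rewrite W1E memv_line.
have [|u [W2u Su wu]] := exists_sphere5_orthogonal Sw W2w; first by rewrite d2.
have [g [SUg gu gw]] := SU3_completion Su Sw wu.
have [_ _ df2 _] := act_flag_full (SU3_unit SUg) (flag0_full R).
exists g => //; rewrite /= !limgD !limg_line !lfunE /= gu gw W1E.
congr (_, (_, _, _)); last exact/lker0_limgf/lker0_mulmx/SU3_unit.
apply/eqP; rewrite eqEdim subv_add -!memvE W2w W2u /= d2.
by move: df2; rewrite limgD !limg_line !lfunE /= gu gw => ->.
Qed.

Lemma SU3_stab_FL2 (R : realType) (g : 'M[R[i]]_3) :
  SU3 g /\ gact g ((delta_mx i2 0, flag0 R) : gpoint (FL2 R)) =
           (delta_mx i2 0, flag0 R) <-> U1 g.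
Proof.
split=> [[SUg gp]|U1g]; last first.
  have SUg := U1_SU3 U1g; split=> //.
  have ge3 : g *m delta_mx i2 0 = delta_mx i2 (0 : 'I_1).
    by case: U1g => a _ <-; rewrite -colE; apply: colvec3P; rewrite !mxE.
  have ge1 : g *m delta_mx i0 0 = g i0 i0 *: delta_mx i0 (0 : 'I_1).
    by case: U1g => a _ <-; rewrite -colE; apply: colvec3P;
      rewrite !mxE /= ?mulr0 ?mulr1.
  have [_ _ d2 _] := flag0_full R.
  have [_ _ df2 _] := act_flag_full (SU3_unit SUg) (flag0_full R).
  congr (_, (_, _, _)) => //.
  - by rewrite limg_line lfunE /= ge3.
  - apply/eqP; rewrite eqEdim df2 d2 leqnn andbT limgD !limg_line !lfunE /=.
    by rewrite ge3 ge1 addvS // -memvE memvZ // memv_line.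
  - exact/lker0_limgf/lker0_mulmx/SU3_unit.
have [ug dg] := SUg.
have ge3 : g *m delta_mx i2 0 = delta_mx i2 0 := congr1 fst gp.
have [g02 g12 g22 g20 g21] := SU3_fixes_e3_row SUg ge3.
(* The image of e_1 stays in the span of e_3 and e_1, so its middle coordinate vanishes. *)
have g10 : g i1 i0 = 0.
  have W2E : (linfun (mulmx g) @: (flag0 R).1.2)%VS = (flag0 R).1.2.
    by have := congr1 (fun p => p.2.1.2) gp.
  have : linfun (mulmx g) (delta_mx i0 0 : 'cV[R[i]]_3) \in (flag0 R).1.2.
    by rewrite -W2E memv_img // (subvP (addvSr _ _)) // memv_line.
  rewrite lfunE /= -colE => /memv_addP[_ /vlineP[k ->] [_ /vlineP[l ->]]].
  by move=> /colP/(_ i1); rewrite !mxE /= !mulr0 addr0.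
have gE : g i0 i0 * g i1 i1 = 1.
  by move: dg; rewrite det3E g02 g12 g22 g20 g21 g10 => <-; ring.
apply: U1P => //.
(* Orthogonality of the first two columns now reduces to conj(g_00) g_01 = 0, and g_00 is nonzero by
   the determinant. *)
have /matrixP/(_ i0 i1) := ug; rewrite mulmx3E !mxE.
rewrite g10 g20 conjc0 !mul0r !addr0.
move=> /eqP; rewrite mulf_eq0 => /orP[/eqP cg|/eqP//].
move/eqP: gE; rewrite -[g i0 i0]conjcK cg conjc0 mul0r eq_sym.
by rewrite oner_eq0.
Qed.

Lemma represented_as_FL2 (R : realType) :
  represented_as (FL2 R) (@SU3 R) (@U1 R).
Proof.
apply: (@represented_as_intro R (FL2 R)
  ((delta_mx i2 0, flag0 R) : gpoint (FL2 R))).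
- by move=> [v V] _; rewrite /= mul1mx act_flag1.
- by move=> g h [v V] _ _ _; rewrite /= mulmxA act_flagM.
- apply/SU3_orbit_FL2; exists 1%:M; first by case: (SU3_group R).
  exact: congr2 (mul1mx _) (act_flag1 _).
- exact: SU3_orbit_FL2.
- exact: SU3_stab_FL2.
Qed.

(** * The automorphism sigma *)

Lemma differentiable_bigsum (K : numFieldType) (V : normedModType K) (I : Type)
    (r : seq I) (f : I -> V -> K) (x : V) :
    (forall i, differentiable (f i) x) ->
  differentiable (fun h => \sum_(i <- r) f i h) x.
Proof.
move=> df; elim: r => [|i r IHr].
  rewrite (_ : (fun _ => _) = cst 0); first exact: differentiable_cst.
  by apply/funext => h; rewrite big_nil.
rewrite (_ : (fun _ => _) = f i + (fun h => \sum_(j <- r) f j h)).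
  exact: differentiableD.
by apply/funext => h; rewrite big_cons.
Qed.

Lemma differentiable_bigprod (K : numFieldType) (V : normedModType K) (I : Type)
    (r : seq I) (f : I -> V -> K) (x : V) :
    (forall i, differentiable (f i) x) ->
  differentiable (fun h => \prod_(i <- r) f i h) x.
Proof.
move=> df; elim: r => [|i r IHr].
  rewrite (_ : (fun _ => _) = cst 1); first exact: differentiable_cst.
  by apply/funext => h; rewrite big_nil.
rewrite (_ : (fun _ => _) = f i * (fun h => \prod_(j <- r) f j h)).
  exact: differentiableM.
by apply/funext => h; rewrite big_cons.
Qed.

Lemma differentiable_mull (K : numFieldType) (V : normedModType K) (c : K)
    (f : V -> K) (x : V) :
  differentiable f x -> differentiable (fun h => c * f h) x.
Proof. by move=> df; exact: (differentiableM (differentiable_cst c x) df). Qed.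

Lemma differentiable_subc (K : numFieldType) (V : normedModType K) (c : K)
    (f : V -> K) (x : V) :
  differentiable f x -> differentiable (fun h => f h - c) x.
Proof. by move=> df; exact: (differentiableB df (differentiable_cst c x)). Qed.

Lemma differentiable_det (K : numFieldType) (V : normedModType K) (n : nat)
    (A : V -> 'M[K]_n) (x : V) :
    (forall i j, differentiable (fun h => A h i j) x) ->
  differentiable (fun h => \det (A h)) x.
Proof.
move=> dA; apply: differentiable_bigsum => s.
exact/differentiable_mull/differentiable_bigprod.
Qed.

Lemma differentiable_adj (K : numFieldType) (n : nat) (i j : 'I_n)
    (x : 'M[K]_n) :
  differentiable (fun h : 'M[K]_n => \adj h i j) x.
Proof.
rewrite (_ : (fun _ => _) = fun h => cofactor h j i); last first.
  by apply/funext => h; rewrite mxE.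
apply/differentiable_mull/differentiable_det => k l.
rewrite (_ : (fun _ => _) = fun h : 'M[K]_n => h (lift j k) (lift i l)).
  exact: differentiable_coord.
by apply/funext => h; rewrite !mxE.
Qed.

(** A single extension F to all of M_n(K) serves at every point of S. *)
Lemma holomorphic_mapT (K : numFieldType) (n : nat) (S : set 'M[K]_n)
    (s F : 'M[K]_n -> 'M[K]_n) :
    (forall i j x, differentiable (fun h => F h i j) x) ->
    (forall h, S h -> s h = F h) ->
  holomorphic_map S s.
Proof.
move=> dF sF g Sg; exists setT, F; split=> //; first exact: openT.
  by move=> i j x _; exact: dF.
by move=> h Sh _; exact: sF.
Qed.

(** * SL_3 with tau and sigma, and the 6-symmetric structure *)

Lemma SL3_complex_lie_group (R : realType) : complex_lie_group (@SL3 R).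
Proof.
split; first exact: SL3_group.
exists unit, (fun _ h => \det h - 1); split; first move=> _ x _.
  apply/differentiable_subc/differentiable_det => i j.
  exact: differentiable_coord.
apply/seteqP; split=> g; first by move=> dg; rewrite /= dg subrr (SL3_unit dg).
by move=> [_ /(_ tt)/eqP]; rewrite subr_eq0 => /eqP.
Qed.

Lemma SL3_conj_tr (R : realType) (g : 'M[R[i]]_3) :
  SL3 g -> SL3 (conj_mx g)^T.
Proof. by move=> dg; rewrite /SL3 /= det_tr det_conj_mx dg conjc1. Qed.

Lemma tau3_involution (R : realType) :
  antiholomorphic_involution (@SL3 R) (@tau3 R).
Proof.
have [_ SLM SLV] := SL3_group R.
split.
- split=> [g Sg|g h Sg Sh]; first by have [] := SLV _ (SL3_conj_tr Sg).
  rewrite /tau3 conj_mxM trmx_mul invmx_mul //;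
    by apply/SL3_unit/SL3_conj_tr.
- move=> g Sg; rewrite /tau3 conj_mx_inv conj_mx_tr conj_mxK trmx_inv trmxK.
  by rewrite invmxK.
(* The conjugate of tau(h) is the inverse transpose of h, which on SL_3 is the transposed
   adjugate. *)
apply: (@holomorphic_mapT _ _ _ _ (fun h => (\adj h)^T)).
  move=> i j x; rewrite (_ : (fun _ => _) = fun h => \adj h j i).
    exact: differentiable_adj.
  by apply/funext => h; rewrite mxE.
move=> h Sh; rewrite /tau3 conj_mx_inv conj_mx_tr conj_mxK -trmx_inv.
by rewrite SL3_invmx_adj.
Qed.

Lemma Fix_tau3 (R : realType) : @SU3 R = Fix (@SL3 R) (@tau3 R).
Proof.
apply/seteqP; split=> [g SUg|g [Sg tg]].
  split; first exact: SU3_SL3.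
  by rewrite /tau3 -(SU3_invmx SUg) invmxK.
split=> //; rewrite -{2}tg /tau3 mulmxV //.
exact/SL3_unit/SL3_conj_tr.
Qed.

Lemma sigma6_SL3 (R : realType) (g : 'M[R[i]]_3) : SL3 g -> SL3 (sigma6 g).
Proof.
move=> dg; rewrite /SL3 /sigma6 /= !det_mulmx mulrAC -det_mulmx.
by rewrite Pmx_involutive det1 mul1r det_inv det_tr dg invr1.
Qed.

(** The two inverse transposes cancel on g, while P^T is its own inverse because P is. Both outer
    factors are diagonal. *)
Lemma sigma6_sigma6 (R : realType) (g : 'M[R[i]]_3) : g \in unitmx ->
  sigma6 (sigma6 g) = Pmx R *m (Pmx R)^T *m g *m ((Pmx R)^T *m Pmx R).
Proof.
move=> ug; have uP := Pmx_unit R; have uPT : (Pmx R)^T \in unitmx.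
  by rewrite unitmx_tr.
have ugT : invmx g^T \in unitmx by rewrite unitmx_inv unitmx_tr.
rewrite {1}/sigma6 /sigma6 !trmx_mul -trmx_inv trmxK.
rewrite !invmx_mul ?unitmx_mul ?unitmx_inv ?uPT ?ug //.
rewrite invmxK -trmx_inv invmx_Pmx.
by rewrite !mulmxA.
Qed.

Lemma sigma6_twice_entry (R : realType) (g : 'M[R[i]]_3) (i j : 'I_3) :
    g \in unitmx ->
  sigma6 (sigma6 g) i j = [:: omega R ^+ 2; omega R; 1]`_i * g i j *
                          [:: omega R; omega R ^+ 2; 1]`_j.
Proof.
move=> ug; rewrite sigma6_sigma6 // Pmx_trPmx trPmx_Pmx.
by move: i j; apply: forall_ord3; apply: forall_ord3;
  rewrite !mulmx3E !mxE /= ?(mul0r, mulr0, add0r, addr0, mulr1, mul1r).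
Qed.

(** P only mixes the two equal diagonal entries, so it commutes with these matrices and sigma
    inverts them. They detect the odd powers of sigma. *)
Lemma sigma6_diag (R : realType) (t : R[i]) : t != 0 ->
  sigma6 (mx3 [:: [:: t; 0; 0]; [:: 0; t; 0]; [:: 0; 0; t ^- 2]]) =
  mx3 [:: [:: t^-1; 0; 0]; [:: 0; t^-1; 0]; [:: 0; 0; t ^+ 2]].
Proof.
move=> t0; set g := mx3 _; set h := mx3 _.
have gh : g^T *m h = 1%:M.
  apply: matrix3P; rewrite mulmx3E !mxE /=
    ?(mul0r, mulr0, add0r, addr0, mulr1) ?mulfV //.
  by rewrite mulVf // expf_neq0.
have [ug _] := mulmx1_unit gh.
have -> : sigma6 g = Pmx R *m h *m Pmx R.
  rewrite /sigma6; congr (_ *m _ *m _).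
  by rewrite -[LHS]mulmx1 -gh mulKmx.
have w3 := omega3 R.
rewrite PmxE; apply: matrix3P; rewrite !mulmx3E !mxE /=
    ?(mul0r, mulr0, add0r, addr0, mulr1, mul1r) //;
  by rewrite mulrAC -?exprS -?exprSr w3 mul1r.
Qed.

(** The square of sigma multiplies each entry by a b with a and b cube roots of unity; its third
    power multiplies by a^3 b^3 = 1. *)
Lemma sigma6_iter6 (R : realType) (g : 'M[R[i]]_3) :
  SL3 g -> iter 6 (@sigma6 R) g = g.
Proof.
move=> Sg; have S2 (h : 'M[R[i]]_3) : SL3 h -> SL3 (sigma6 (sigma6 h)).
  by move=> ?; do 2!apply: sigma6_SL3.
have Sg2 := S2 _ Sg; have Sg4 := S2 _ Sg2.
apply/matrixP => i j /=.
rewrite (sigma6_twice_entry _ _ (SL3_unit Sg4)).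
rewrite (sigma6_twice_entry _ _ (SL3_unit Sg2)).
rewrite (sigma6_twice_entry _ _ (SL3_unit Sg)).
have w3 := omega3 R; have w6 : (omega R ^+ 2) ^+ 3 = 1.
  by rewrite -exprM mulnC exprM w3 expr1n.
set a := nth _ _ i; have a3 : a ^+ 3 = 1.
  by rewrite /a; move: i {a}; apply: forall_ord3; rewrite //= expr1n.
set b := nth _ _ j; have b3 : b ^+ 3 = 1.
  by rewrite /b; move: j {b}; apply: forall_ord3; rewrite //= expr1n.
by rewrite -[RHS]mul1r -[RHS]mulr1 -{1}a3 -b3; ring.
Qed.

Lemma sigma6_automorphism (R : realType) :
  automorphism_of_order 6 (@SL3 R) (@sigma6 R).
Proof.
split=> //; last 1 first.
(* For odd exponents the witness is d(2) = diag(2, 2, 1/4), which sigma exchanges with its inverse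
   d(1/2). *)
- have t0 : (2 : R[i]) != 0 by rewrite pnatr_eq0.
  pose d (t : R[i]) := mx3 [:: [:: t; 0; 0]; [:: 0; t; 0]; [:: 0; 0; t ^- 2]].
  have Sd t : t != 0 -> SL3 (d t).
    by move=> t0'; rewrite /SL3 /= det3E !mxE /=; field.
  have sd t : t != 0 -> sigma6 (d t) = d t^-1.
    by move=> t0'; rewrite sigma6_diag // /d exprVn invrK.
  have sd2 : sigma6 (d 2^-1) = d 2 by rewrite sd ?invr_eq0 // invrK.
  have dneq : d 2^-1 <> d 2.
    move=> /matrixP/(_ i0 i0); rewrite !mxE /= => e.
    have /eqP : (2 * 2 : R[i]) = 1 by rewrite -{1}e mulVf.
    by rewrite -natrM (eqr_nat _ 4 1).
  (* For the exponents 2 and 4 the witness is unipotent: each application of sigma^2 multiplies its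
     (0,2) entry by omega^2. *)
  pose u : 'M[R[i]]_3 := mx3 [:: [:: 1; 0; 1]; [:: 0; 1; 0]; [:: 0; 0; 1]].
  have Su : SL3 u by rewrite /SL3 /= det3E !mxE /=; ring.
  have su l : iter l (@sigma6 R \o @sigma6 R) u i0 i2 = omega R ^+ (2 * l).
    elim: l => [|l IHl]; first by rewrite !mxE.
    rewrite iterS /= sigma6_twice_entry.
      by rewrite IHl /= mulr1 -exprD mulnS.
    apply: SL3_unit; elim: l {IHl} => //= l IHl.
    by do 2!apply: sigma6_SL3.
  have w1 := omega_neq1 R; have w3 := omega3 R.
  case=> [|[|[|[|[|[|l]]]]]] // _ /=.
  + by exists (d 2); [exact: Sd | rewrite sd].
  + exists u => // e; have := su 1%N; rewrite /= e !mxE /= => /esym w2.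
    by move/eqP: w1; apply; rewrite -w3 exprSr w2 mul1r.
  + by exists (d 2); [exact: Sd | rewrite sd // sd2 sd].
  + exists u => // e; have := su 2%N; rewrite /= e !mxE /= => /esym.
    by rewrite exprSr w3 mul1r => w; move/eqP: w1.
  + by exists (d 2); [exact: Sd | rewrite sd // sd2 sd // sd2 sd].
- split=> [g|g h Sg Sh]; first exact: sigma6_SL3.
  rewrite /sigma6 trmx_mul invmx_mul ?unitmx_tr ?SL3_unit //.
  by rewrite !mulmxA -(mulmxA _ (Pmx R) (Pmx R)) Pmx_involutive mulmx1.
- apply: (@holomorphic_mapT _ _ _ _ (fun h => Pmx R *m (\adj h)^T *m Pmx R)).
    move=> i j x.
    (* Each entry is a constant linear combination of entries of the adjugate. *)
    rewrite (_ : (fun _ => _) = fun h => \sum_k \sum_l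
      (Pmx R k j * Pmx R i l) * \adj h k l).
      apply: differentiable_bigsum => k; apply: differentiable_bigsum => l.
      exact/differentiable_mull/differentiable_adj.
    apply/funext => h; rewrite mxE; apply: eq_bigr => k _.
    rewrite mxE mulr_suml; apply: eq_bigr => l _.
    by rewrite [(\adj h)^T l k]mxE mulrAC (mulrC (_ i l)).
  by move=> h Sh; rewrite /sigma6 -trmx_inv SL3_invmx_adj.
exact: sigma6_iter6.
Qed.

(** As Fix(SU_3, sigma) is exactly U_1, the two required inclusions are that of a connected
    component in its set and an equality. *)
Lemma U1_k_symmetric (R : realType) :
  k_symmetric_space 6 (@SL3 R) (@tau3 R) (@sigma6 R) (@SU3 R) (@U1 R).
Proof.
have FixE : Fix (@SU3 R) (@sigma6 R) = @U1 R.
  apply/seteqP; split=> g.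
    move=> [SUg sg]; apply/SU3_stab_Pmx; split=> //.
    rewrite -{1}sg /sigma6 -!mulmxA (mulmxA (Pmx R) (Pmx R)) Pmx_involutive.
    by rewrite mul1mx mulVmx ?mulmx1 // unitmx_tr SU3_unit.
  move/SU3_stab_Pmx => [SUg gP]; split=> //.
  rewrite /sigma6 -{1}gP -!mulmxA (mulmxA g^T) mulmxV ?unitmx_tr ?SU3_unit //.
  by rewrite mul1mx Pmx_involutive mulmx1.
split; split.
- exact: SL3_complex_lie_group.
- exact: tau3_involution.
- by split=> //; exact: sigma6_automorphism.
(* Both composites send g to P conj(g) P. *)
- move=> g Sg; rewrite /sigma6 /tau3 !conj_mxM !trmx_mul conj_Pmx_tr.
  rewrite conj_mx_inv !conj_mx_tr trmx_inv trmxK invmxK.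
  have uc : conj_mx g \in unitmx.
    by rewrite -unitmx_tr (SL3_unit (SL3_conj_tr Sg)).
  rewrite !invmx_mul ?unitmx_mul ?Pmx_unit ?unitmx_inv ?uc //.
  by rewrite invmx_Pmx invmxK.
- exact: Fix_tau3.
- exact: U1_group.
- by rewrite FixE; exact: connected_component_sub.
- by rewrite FixE.
Qed.

Theorem corollary3p4 (R : realType) :
  (forall j : 'I_3,
     represented_as (FL R j) (@SU3 R) (@U1 R) /\
     k_symmetric_space 6 (@SL3 R) (@tau3 R) (@sigma6 R) (@SU3 R) (@U1 R)) /\
  (forall j m : 'I_3,
     exists phi : gpoint (FL R m) -> gpoint (FL R j),
       diffeomorphism (FL R m) (FL R j) phi /\ equivariant (FL R m) (FL R j) phi).
Proof.
have rep j : represented_as (FL R j) (@SU3 R) (@U1 R).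
  move: j; apply: forall_ord3.
  - exact: represented_as_FL1.
  - exact: represented_as_FL2.
  - exact: represented_as_FL3.
split=> [j|j m]; first by split; [exact: rep | exact: U1_k_symmetric].
exact: same_stabilizer_diffeomorphism (SU3_group R) (rep m) (rep j).
Qed.
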